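(* Let $X$ be a geodesic metric space with base point $x\in X$, and let $k\in\mathbb N$. If $(X,x)$ admits an $(\varepsilon,k)$-tight geodesic combing for some $\varepsilon>0$, then $\operatorname{asdim}_{AN}(X)\le k$.
   Context: Here $\mathbb N=\{0,1,2,\dots\}$ and $B(y,s)$ is the open ball of radius $s$ about $y$. **Geodesic combings.** A subspace $Y\subseteq X$ is cobounded if there is a constant $c>0$ with $d(z,Y)\le c$ for all $z\in X$. A geodesic combing of the pointed geodesic metric space $(X,x)$ is a set $T=\{T_y\mid y\in Y\}$, where $Y$ is a cobounded subset of $X$ and $T_y$ is a geodesic from $x$ to $y$ for each $y\in Y$. For $y\in Y$ and $s>0$ let $T(y,s)=\bigcup\{T_{y'}\mid y'\in Y\cap B(y,s)\}$, and for $t\ge 0$ let $S(t)=\{x'\in X\mid d(x,x')=t\}$. **Tightness.** For $\varepsilon>0$ and $k\in\mathbb N$, $T$ is $(\varepsilon,k)$-tight if for all $r>0$, all $y\in Y$ and all $t\geq 0$ with $t\le d(x,y)-r$, we have $|T(y,\varepsilon r)\cap S(t)|\le k$. **Dimension.** For a family $\mathcal V$ of subsets of $X$ and $r>0$, the $r$-multiplicity of $\mathcal V$ is the maximum over $z\in X$ of the number of elements of $\mathcal V$ meeting $B(z,r)$ ($\infty$ if there is no finite maximum). For $n\in\mathbb N$, write $\operatorname{asdim}_{AN}(X)\le n$ (asymptotic Assouad-Nagata dimension at most $n$) if there exist constants $a,b>0$ such that for every $r>0$ there is a cover $\mathcal V$ of $X$ with $r$-multiplicity at most $n+1$ and $\operatorname{diam}(V)\le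 ar+b$ for all $V\in\mathcal V$. *)

(* Defs.v *)
From HB Require Import structures.
From mathcomp Require Import all_boot all_order all_algebra.
From mathcomp Require Import all_classical all_reals all_analysis.

Set Implicit Arguments.
Unset Strict Implicit.
Unset Printing Implicit Defensive.
Import Order.TTheory GRing.Theory Num.Theory.

Local Open Scope classical_set_scope.
Local Open Scope card_scope.
Local Open Scope ring_scope.

Section Metric.
Context {R : realType} {X : metricType R}.

(* A geodesic from x to y is identified with its image in X. Only the values
   of g on [0, d(x, y)] matter. *)
Definition is_geodesic (x y : X) (A : set X) : Prop :=
  exists g : R -> X,
    [/\ g 0 = x,
        g (mdist x y) = y,
        {in `[0, mdist x y] &, forall s t, mdist (g s) (g t) = `|s - t|}
      & A = g @` [set` `[0, mdist x y]]].

(* d(z, Y) is the extended infimum [edist_inf Y z], equal to +oo for Y = set0;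
   thus a cobounded subset of a nonempty space is nonempty. *)
Definition cobounded (Y : set X) : Prop :=
  exists2 c : R, 0 < c & forall z : X, (edist_inf Y z <= c%:E)%E.

(* The combing {T_y | y in Y} is encoded by Y and a map T : X -> set X whose
   values outside Y are never used. *)
Definition geodesic_combing (x : X) (Y : set X) (T : X -> set X) : Prop :=
  cobounded Y /\ forall y, Y y -> is_geodesic x y (T y).

Definition combing_nbhd (Y : set X) (T : X -> set X) (y : X) (s : R) : set X :=
  \bigcup_(y' in Y `&` ball y s) T y'.

Definition metric_sphere (x : X) (t : R) : set X := [set x' | mdist x x' = t].

Definition tight_combing (eps : R) (k : nat) (x : X) (Y : set X)
    (T : X -> set X) : Prop :=
  forall (r : R) (y : X) (t : R),
    0 < r -> Y y -> 0 <= t -> t <= mdist x y - r ->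
    combing_nbhd Y T y (eps * r) `&` metric_sphere x t #<= `I_k.

Definition multiplicity_le (r : R) (m : nat) (F : set (set X)) : Prop :=
  forall z : X, [set V | F V /\ V `&` ball z r !=set0] #<= `I_m.

(* The diameter of set0 is -oo here. *)
Definition diam (V : set X) : \bar R :=
  ereal_sup [set (mdist p.1 p.2)%:E | p in V `*` V].

End Metric.

Definition geodesic_space {R : realType} (X : metricType R) : Prop :=
  forall x y : X, exists A : set X, is_geodesic x y A.

Definition asdimAN_le {R : realType} (X : metricType R) (n : nat) : Prop :=
  exists a b : R, [/\ 0 < a, 0 < b &
    forall r : R, 0 < r -> exists F : set (set X),
      [/\ \bigcup_(V in F) V = [set: X],
          multiplicity_le r n.+1 F
        & forall V, F V -> (diam V <= (a * r + b)%:E)%E]].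

(* Main.v *)
Require Import Defs.
From mathcomp Require Import all_boot all_order all_algebra.
From mathcomp Require Import all_classical all_reals all_analysis.
From mathcomp Require Import finmap wochoice lra.

(** Why the theorem is true. Fix [r] and look at the points of [Y] only, which
    are coarsely dense. A point [y] far from [x] can be labelled by a point [b]
    of its geodesic [T y], taken on the sphere of radius [m * delta] about [x],
    where [m * delta] is the largest multiple of [delta] below [d x y - rho].
    A label determines [y] up to bounded distance, and tightness says that
    nearby points have at most [k] labels in all as long as they use the same [m].
    Where [m] jumps, however, labels from two levels meet, and the naive
    multiplicity is [2 * k].

    The remedy is to map into a telescope. The labels of level [m] that can
    be seen from one place span a simplex with at most [k] vertices, and a
    vertex [b] of one level has a [parent] on the level below, so that the
    levels are glued by simplicial mapping cylinders, of dimension at most [k].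
    Once the vertices are totally ordered, a mapping cylinder is triangulated by
    the simplices [b_1 < ... < b_i, parent b_i, ..., parent b_n]: at most one
    vertex occurs together with its own parent, hence at most [k + 1] vertices.
    Concretely, [y] gives each visible [b] a [weight]; segments of these
    lengths are laid along a line in the chosen order, [b] starting at
    [offset b y]; the line is cut at [height b y], which grows with [d x y]. A
    segment lying well below the cut makes [b] a label of [y], one lying well
    above makes [parent b] a label, and at most one segment contains the cut
    ([card_le_cut]). All of these functions are Lipschitz, and a label is only
    granted with a margin, so the labels of all points of a small set [S] are
    already visible from any one point of [S] ([label_card_same]).

    Points of a small set that meets two consecutive windows use only labels of
    the level of the lower window: the upper ones are low in their cylinder and
    use parents, the lower ones are high in theirs. The parent of [b] is taken
    on a geodesic that ends shortly above [b], hence within [eps * delta] of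
    these points when [delta] is a large enough multiple of [rho]; so tightness
    at scale [delta] bounds all these labels by [k] together
    ([label_card_step]). All constants are proportional to [r] up to an additive
    constant, which gives the linear bound on diameters. *)

Set Implicit Arguments.
Unset Strict Implicit.
Unset Printing Implicit Defensive.
Import Order.TTheory GRing.Theory Num.Theory.

Local Open Scope classical_set_scope.
Local Open Scope card_scope.
Local Open Scope ring_scope.

(** * Counting, total orders and sums over sequences *)

Lemma card_le_seqP (T : choiceType) (A : set T) (n : nat) :
  A #<= `I_n -> exists2 s : seq T, uniq s /\ (size s <= n)%N & A = [set` s].
Proof.
move=> An; have finA : finite_set A by apply/finite_set_leP; exists n.
exists (fset_set A); first by split; [exact: fset_uniq | exact: geq_card_fset_set].
by rewrite fset_setK.
Qed.

Lemma seq_card_le (T : choiceType) (A : set T) (s : seq T) (n : nat) :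
  A `<=` [set` s] -> (size s <= n)%N -> A #<= `I_n.
Proof.
move=> As sn; have finA : finite_set A by exact: sub_finite_set As (finite_seq s).
have [m Am] := (finite_setP A).1 finA.
rewrite (card_le_eql Am) card_le_II -(card_fset_set Am) (leq_trans _ sn)//.
apply: uniq_leq_size; first exact: fset_uniq.
by move=> b; rewrite in_fset_set// => /set_mem/As.
Qed.

(** The count behind the dimension of a triangulated mapping cylinder:
    [#|U| + #|L| = #|U `|` L| + #|U `&` L|], and the last term is at most 1. *)
Lemma card_le_cut (T : choiceType) (A U L : set T) (g : T -> T) (k : nat) :
  A #<= `I_k -> U `<=` A -> L `<=` A ->
  (forall b b', U b -> L b -> U b' -> L b' -> b = b') ->
  U `|` g @` L #<= `I_k.+1.
Proof.
move=> /card_le_seqP[s [us sk] ->] US LS UL1.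
pose u : pred T := fun b => b \in U; pose l : pred T := fun b => b \in L.
apply: (@seq_card_le _ _ ([seq b <- s | u b] ++ [seq g b | b <- s & l b])).
  move=> b [Ub|[b' Lb' <-]] /=; rewrite mem_cat mem_filter.
    by rewrite /u mem_set//= US.
  apply/orP; right; apply: map_f.
  by rewrite mem_filter /l mem_set//= LS.
rewrite size_cat size_map !size_filter -count_predUI -addn1 leq_add//.
  by apply: leq_trans sk; exact: count_size.
rewrite -size_filter.
have : uniq [seq b <- s | predI u l b] by exact: filter_uniq.
have : forall b b', b \in [seq b <- s | predI u l b] -> b' \in [seq b <- s | predI u l b] ->
    b = b'.
  move=> b b'; rewrite !mem_filter /= /u /l.
  move=> /andP[/andP[/set_mem ? /set_mem ?] _] /andP[/andP[/set_mem ? /set_mem ?] _].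
  exact: UL1.
case: [seq b <- s | _] => [|b [|b' t]]//= /(_ b b').
by rewrite !inE !eqxx !orbT/= => ->; rewrite ?eqxx.
Qed.

(** Any total order would do to order the vertices of the cylinders; the one at
    hand comes from a well-ordering. *)
Lemma strict_total_order_exists (T : eqType) : exists lt : rel T,
  [/\ irreflexive lt, transitive lt & forall a b, a != b -> lt a b || lt b a].
Proof.
have [R Rwo] := well_ordering_principle T.
have Rc : wo_chain R predT by move=> A _; exact: Rwo.
have Rtot a b : R a b || R b a by exact: (wo_chainW Rc).
have Ranti a b : R a b -> R b a -> a = b.
  by move=> ab ba; apply: (wo_chain_antisymmetric Rc) => //; apply/andP.
exists (fun a b => (a != b) && R a b); split.
- by move=> a; rewrite eqxx.
- move=> b a c /andP[ab Rab] /andP[bc Rbc].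
  (* Transitivity follows from inspecting the minimum of the three points. *)
  have [|m [[m_in mmin] _]] := Rwo (mem [:: a; b; c]).
    by exists a; rewrite inE eqxx.
  have [Ra Rb Rd] : [/\ R m a, R m b & R m c].
    by split; apply: mmin; rewrite !inE eqxx ?orbT.
  move: m_in; rewrite !inE => /or3P[] /eqP mE; subst m.
  + rewrite Rd andbT; apply: contra_neq bc => ac.
    by subst c; apply: Ranti.
  + by move: ab; rewrite (Ranti a b)// eqxx.
  + by move: bc; rewrite (Ranti b c)// eqxx.
- move=> a b ab; rewrite (eq_sym b) ab/=; exact: Rtot.
Qed.

Lemma le_sum_seq_subset (R : realDomainType) (T : eqType) (s s' : seq T) (P : pred T)
    (f : T -> R) :
  uniq s -> uniq s' -> (forall b, 0 <= f b) ->
  (forall b, b \in s -> 0 < f b -> b \in s') ->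
  \sum_(b <- s | P b) f b <= \sum_(b <- s' | P b) f b.
Proof.
move=> us us' f0 ss'.
rewrite (bigID (mem s')) /= [X in _ + X <= _]big_seq_cond
  [X in _ + X <= _]big1 ?addr0; last first.
  move=> b /andP[bs /andP[_ bs']]; apply/eqP; rewrite eq_le f0 andbT leNgt.
  by apply: contra bs' => /(ss' _ bs).
rewrite [leRHS](bigID (mem s))/=.
have -> : \sum_(b <- s | P b && (b \in s')) f b =
    \sum_(b <- s' | P b && (b \in s)) f b.
  under eq_bigl do rewrite andbC.
  under [RHS]eq_bigl do rewrite andbC.
  rewrite -!big_filter_cond; apply: perm_big; apply: uniq_perm;
    rewrite ?filter_uniq// => b.
  by rewrite !mem_filter andbC.
by rewrite lerDl sumr_ge0.
Qed.

Lemma sum_seq_add_le (R : realDomainType) (T : eqType) (s : seq T) (P Q : pred T)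
    (f : T -> R) (a : T) :
  uniq s -> (forall b, 0 <= f b) -> a \in s -> ~~ P a -> Q a ->
  (forall b, P b -> Q b) ->
  \sum_(b <- s | P b) f b + f a <= \sum_(b <- s | Q b) f b.
Proof.
move=> us f0 sa Pa Qa PQ; rewrite big_mkcond [leRHS]big_mkcond/=.
rewrite (bigD1_seq a)//= [leRHS](bigD1_seq a)//= (negbTE Pa) Qa add0r [leLHS]addrC lerD2l.
apply: ler_sum => b _; case: ifPn => [/PQ ->//|_].
by case: ifP.
Qed.

(** * A Lipschitz function supported near a set *)

Section Proximity.
Context {R : realType} {X : metricType R}.
Implicit Types (A : set X) (D : R) (y z w : X).

(** This is [max 0 (D - d(y, A))], as a supremum that makes sense for [A = set0]
    too. *)
Definition proximity D A y : R :=
  sup [set u | u = 0 \/ exists2 w, A w & u = D - mdist y w].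

Lemma proximity_ubound D A y : 0 <= D ->
  ubound [set u | u = 0 \/ exists2 w, A w & u = D - mdist y w] D.
Proof. by move=> D0 _ [->|[w _ ->]]//; rewrite gerBl mdist_ge0. Qed.

Lemma proximity_le D A y : 0 <= D -> proximity D A y <= D.
Proof. by move=> D0; apply: ge_sup; [exists 0; left | exact: proximity_ubound]. Qed.

Lemma proximity_ge0 D A y : 0 <= D -> 0 <= proximity D A y.
Proof.
by move=> D0; apply: ub_le_sup; [exists D; exact: proximity_ubound | left].
Qed.

Lemma proximity_ge D A y w : 0 <= D -> A w -> D - mdist y w <= proximity D A y.
Proof.
move=> D0 Aw; apply: ub_le_sup; first by exists D; exact: proximity_ubound.
by right; exists w.
Qed.

Lemma proximity_gt0 D A y : 0 <= D -> 0 < proximity D A y ->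
  exists2 w, A w & mdist y w < D.
Proof.
rewrite /proximity => D0; set E := (X in sup X) => p0; have supE : has_sup E.
  by split; [exists 0; left | exists D; exact: proximity_ubound].
have [u] := sup_adherent p0 supE; rewrite subrr => -[->|[w Aw ->]].
  by rewrite ltxx.
by rewrite subr_gt0 => yw; exists w.
Qed.

Lemma proximity_lipschitz D A y z : 0 <= D ->
  proximity D A y <= proximity D A z + mdist y z.
Proof.
move=> D0; apply: ge_sup; first by exists 0; left.
move=> _ [->|[w Aw ->]]; first by rewrite addr_ge0 ?proximity_ge0 ?mdist_ge0.
have := proximity_ge z D0 Aw; have := metric_triangle z y w.
by rewrite (metric_sym z y); lra.
Qed.

End Proximity.

(** * Labelling the points of a tight combing *)

Section AnnularCover.
Context {R : realType} {X : metricType R}.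
Variables (x : X) (Y : set X) (T : X -> set X) (eps : R) (k : nat).
Variable lt : rel X.
(* [e] bounds the diameter of the sets whose labels are counted, [D] is the
   range and the maximum of the weights, [rho] the depth at which tightness is
   used for neighbourhoods of radius [D], and [delta] the distance between
   levels. *)
Variables (e D rho delta : R).
Implicit Types y z w a b v : X.

Let d := @mdist R X.
Local Notation K := (k%:R : R).

Hypothesis lt_irr : irreflexive lt.
Hypothesis lt_tr : transitive lt.
Hypothesis lt_tot : forall a b, a != b -> lt a b || lt b a.

Hypothesis T_level : forall y t, Y y -> 0 <= t -> t <= d x y ->
  exists2 b, T y b & d x b = t.
Hypothesis T_dist : forall y b, Y y -> T y b -> d y b = d x y - d x b.
Hypothesis tight : tight_combing eps k x Y T.

Hypothesis eps0 : 0 < eps.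
Hypothesis e0 : 0 < e.
(* A label comes with a margin [D / 2]; moving by [e] costs at most [e] in the
   weight, [K * e] in the offset and [e] in the height. *)
Hypothesis eD : (K + 2) * e + (K + 2) * e < D.
Hypothesis D_le : D <= eps * rho.
(* Before the next window starts, the cut has passed all segments, whose total
   length is at most [K * D]. *)
Hypothesis delta_ge : K * D + e + D <= delta.
(* The parents used near [y] lie on geodesics ending in the ball of radius
   [eps * delta] about [y]. *)
Hypothesis eps_delta : e + 2 * D + 2 * (rho + (K + 1) * D) <= eps * delta.

Let K0 : 0 <= K. Proof. exact: ler0n. Qed.
Let D0 : 0 < D.
Proof. by apply: le_lt_trans eD; rewrite addr_ge0 // mulr_ge0 ?(ltW e0)// addr_ge0. Qed.
Let eltD : e + e < D.
Proof. have h := mulr_ge0 K0 (ltW e0); have h1 := eD; have h2 := e0; lra. Qed.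
Let KD0 : 0 <= K * D. Proof. by rewrite mulr_ge0 ?(ltW D0). Qed.
Let delta0 : 0 < delta.
Proof. have := KD0; have := D0; have := e0; have := delta_ge; lra. Qed.
Let rho0 : 0 < rho.
Proof. by rewrite -(pmulr_rgt0 _ eps0) (lt_le_trans D0). Qed.

Definition through b := [set w | Y w /\ T w b].

Definition weight b y := proximity D (through b) y.

Definition active t y := [set b | d x b = t /\ 0 < weight b y].

(** Where the segment of [b] starts, when the segments of the active points of the
    level of [b] are laid one after the other in increasing order. *)
Definition offset b y :=
  \sum_(a <- fset_set (active (d x b) y) | lt a b) weight a y.

(** Where the line of segments of the level of [b] is cut: at 0 when [y] enters
    the window of that level. *)
Definition height b y := d x y - rho - d x b.

(** The bound on [d x w] keeps the end of the chosen geodesic close to all the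
    points that use [parent b] as a label, which have no reason to be close to
    an arbitrary end of a geodesic through [b]. *)
Definition parent b :=
  xget b [set a | exists w, [/\ Y w, T w b, T w a, d x a = d x b - delta
    & d x w <= d x b + rho + (K + 1) * D]].

(** The truncation of a negative number is 0, so that window 0 is a ball about
    [x]. *)
Definition window y : nat := Num.truncn ((d x y - rho) / delta).

(** The cylinder coordinates of [y], with a margin [D / 2] that makes labels
    stable: the first alternative says that the part of the segment of [b]
    below the cut has length at least [D / 2], the second one the same for the
    part above the cut. *)
Definition label y v :=
  if window y is m.+1 then
    exists b, [/\ d x b = m.+1%:R * delta, D / 2 <= weight b y &
      (v = b /\ offset b y + D / 2 <= height b y) \/
      (v = parent b /\ height b y + D / 2 <= offset b y + weight b y)]
  else v = x.

Lemma weight_gt0 b y : 0 < weight b y -> exists w, [/\ Y w, T w b & d y w < D].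
Proof. by move=> /(proximity_gt0 (ltW D0))[w [Yw Twb] yw]; exists w. Qed.

Lemma weight_ge0 b y : 0 <= weight b y.
Proof. exact: proximity_ge0 (ltW D0). Qed.

Lemma weight_le b y : weight b y <= D.
Proof. exact: proximity_le (ltW D0). Qed.

Lemma weight1 b y : Y y -> T y b -> weight b y = D.
Proof.
move=> Yy Tyb; apply/eqP; rewrite eq_le weight_le.
have := @proximity_ge _ _ D (through b) y y (ltW D0).
by rewrite mdistxx subr0; apply.
Qed.

(** This is tightness at scale [rho]: active points lie on geodesics that end at
    distance less than [D <= eps * rho] from [y]. *)
Lemma active_card t y : Y y -> 0 <= t -> t <= d x y - rho -> active t y #<= `I_k.
Proof.
move=> Yy t0 ty; apply: card_le_trans (tight rho0 Yy t0 ty).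
apply: subset_card_le => b [xb /weight_gt0[w [Yw Twb yw]]]; split => //.
exists w => //; split => //; rewrite ballEmdist/=.
exact: lt_le_trans yw D_le.
Qed.

Lemma active_finite t y : Y y -> 0 <= t -> t <= d x y - rho ->
  finite_set (active t y).
Proof.
by move=> Yy t0 ty; apply/finite_set_leP; exists k; exact: active_card.
Qed.

Lemma active_size t y : Y y -> 0 <= t -> t <= d x y - rho ->
  (size (fset_set (active t y)) <= k)%N.
Proof. by move=> Yy t0 ty; apply: geq_card_fset_set; exact: active_card. Qed.

Lemma active_mem t y b : Y y -> 0 <= t -> t <= d x y - rho -> d x b = t ->
  0 < weight b y -> b \in (fset_set (active t y) : seq X).
Proof.
by move=> Yy t0 ty xb wb; rewrite in_fset_set ?mem_set//; exact: active_finite.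
Qed.

Let dge0 y z : 0 <= d y z. Proof. exact: mdist_ge0. Qed.

(** The segments of distinct active points of a level do not overlap. *)
Lemma offset_lt a b y : Y y -> d x a <= d x y - rho -> d x a = d x b ->
  0 < weight a y -> lt a b -> offset a y + weight a y <= offset b y.
Proof.
move=> Yy ay ab wa altb; rewrite /offset -ab.
apply: sum_seq_add_le; rewrite ?fset_uniq ?lt_irr//.
- by move=> c; exact: weight_ge0.
- exact: active_mem.
- by move=> c ca; exact: lt_tr ca altb.
Qed.

Lemma offset_weight_le b y : Y y -> d x b <= d x y - rho -> 0 < weight b y ->
  offset b y + weight b y <= K * D.
Proof.
move=> Yy blev wb; set s := fset_set (active (d x b) y).
have bs : b \in (s : seq X) by exact: active_mem.
apply: (@le_trans _ _ (\sum_(a <- s) weight a y)).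
  rewrite /offset -/s; apply: sum_seq_add_le; rewrite ?fset_uniq ?lt_irr//.
  by move=> c; exact: weight_ge0.
apply: (@le_trans _ _ (\sum_(a <- s) D)).
  by apply: ler_sum => a _; exact: weight_le.
rewrite big_const_seq iter_addr_0 -[leLHS]mulr_natl ler_wpM2r ?(ltW D0)//.
rewrite ler_nat (leq_trans (count_size _ _))//; exact: active_size.
Qed.

Lemma weight_lipschitz b y z : d y z < e -> weight b y <= weight b z + e.
Proof.
move=> yz; apply: le_trans (proximity_lipschitz _ _ z (ltW D0)) _.
by rewrite lerD2l ltW.
Qed.

(** Only the at most [k] terms that are active at [y] have to be compared. *)
Lemma offset_lipschitz b y z : Y y -> Y z -> d x b <= d x y - rho ->
  d x b <= d x z - rho -> d y z < e -> offset b y <= offset b z + K * e.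
Proof.
move=> Yy Yz bY bZ yz; rewrite /offset.
set s := fset_set (active (d x b) y); set s' := fset_set (active (d x b) z).
apply: (@le_trans _ _ (\sum_(a <- s | lt a b) (weight a z + e))).
  by apply: ler_sum => a _; exact: weight_lipschitz.
rewrite big_split/= lerD//.
  apply: le_sum_seq_subset; rewrite ?fset_uniq//; first by move=> ?; exact: weight_ge0.
  move=> a; rewrite in_fset_set; last exact: active_finite.
  by move=> /set_mem[ab _] az; exact: active_mem.
rewrite big_const_seq iter_addr_0 -[leLHS]mulr_natl ler_wpM2r ?(ltW e0)//.
rewrite ler_nat (leq_trans (count_size _ _))//; exact: active_size.
Qed.

Lemma height_lipschitz b y z : d y z < e -> height b y < height b z + e.
Proof.
by move=> yz; have := metric_triangle x z y; rewrite (metric_sym z y) -/d /height; lra.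
Qed.

Lemma parentP b w : Y w -> T w b -> delta <= d x b ->
  d x w <= d x b + rho + (K + 1) * D ->
  exists w', [/\ Y w', T w' b, T w' (parent b), d x (parent b) = d x b - delta
    & d x w' <= d x b + rho + (K + 1) * D].
Proof.
move=> Yw Twb bdelta xw; rewrite /parent.
case: xgetP => [a _ //|none].
have xbw : d x b <= d x w by have := T_dist Yw Twb; have := dge0 w b; lra.
have [|| a Twa xa] := @T_level w (d x b - delta) Yw; [lra|have := delta0; lra|].
by case: (none a); exists w.
Qed.

Lemma level_le m n : (m <= n)%N -> m%:R * delta <= n%:R * delta.
Proof. by move=> mn; rewrite ler_wpM2r ?(ltW delta0)// ler_nat. Qed.

Lemma levelS m : m.+1%:R * delta = m%:R * delta + delta.
Proof. by rewrite -natr1 mulrDl mul1r. Qed.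

Lemma window_lt y : d x y < (window y)%:R * delta + delta + rho.
Proof.
have [q0|q0] := leP 0 ((d x y - rho) / delta).
  have /andP[_] := truncn_itv q0; rewrite -/(window y) ltr_pdivrMr// levelS.
  lra.
have : 0 <= (window y)%:R * delta by rewrite mulr_ge0// ltW// delta0.
by move: q0; rewrite ltr_pdivrMr// mul0r; have := delta0; lra.
Qed.

Lemma window_ge y : (0 < window y)%N -> (window y)%:R * delta + rho <= d x y.
Proof.
rewrite truncn_gt0 => q1; have /andP[] := truncn_itv (le_trans ler01 q1).
by rewrite -/(window y) ler_pdivlMr// => + _; lra.
Qed.

(** If part of the segment of [b] is above the cut, then the height is less than
    [K * D], so that [y] is shortly above [b] and the choice defining [parent b]
    succeeds. *)
Lemma parent_reach b y : Y y -> d x b <= d x y - rho -> delta <= d x b ->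
  0 < weight b y -> height b y + D / 2 <= offset b y + weight b y ->
  exists w, [/\ Y w, T w (parent b), d x (parent b) = d x b - delta,
    d y w < D + 2 * (rho + (K + 1) * D)
    & d w (parent b) <= rho + (K + 1) * D + delta].
Proof.
move=> Yy yb bdelta wb hb.
have [w [Yw Twb yw]] := weight_gt0 wb.
have hK := offset_weight_le Yy yb wb.
have xw : d x w <= d x b + rho + (K + 1) * D.
  have := metric_triangle x y w; move: hb; rewrite -/d /height.
  have := D0; lra.
have [w' [Yw' Tw'b Tw'p xp xw']] := parentP Yw Twb bdelta xw.
exists w'; split => //.
  have := T_dist Yw Twb; have := T_dist Yw' Tw'b.
  have := metric_triangle y w w'; have := metric_triangle w b w'.
  by rewrite (metric_sym b w') -/d; lra.
have := T_dist Yw' Tw'p; lra.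
Qed.

Lemma level_ge_del m : delta <= m.+1%:R * delta.
Proof. by have := @level_le 1 m.+1 isT; rewrite mul1r. Qed.

(** The point [b] of [T y] on the level of the window of [y] has the maximal
    weight [D], so that one of the two parts of its segment has length at least
    [D / 2]. *)
Lemma label_exists y : Y y -> exists v, label y v.
Proof.
move=> Yy; rewrite /label; case wy: (window y) => [|m]; first by exists x.
have := @window_ge y; rewrite wy => /(_ isT) xy.
have t0 : 0 <= m.+1%:R * delta by apply: le_trans (level_ge_del m); exact: ltW delta0.
have [|b Tyb xb] := T_level Yy t0; first by have := rho0; lra.
have wb := weight1 Yy Tyb; have D0' := D0.
have [h|h] := leP (offset b y + D / 2) (height b y).
- by exists b, b; split => //; [rewrite wb; lra | left].
- exists (parent b), b; split => //; first by rewrite wb; lra.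
  by right; split => //; rewrite wb; lra.
Qed.

Lemma label_dist y v : Y y -> label y v ->
  d y v <= D + 3 * (rho + (K + 1) * D) + delta.
Proof.
move=> Yy; have KD0' := KD0; have D0' := D0; have rho0' := rho0.
rewrite /label; have := window_lt y; have := @window_ge y.
case: (window y) => [_|m /(_ isT) xy1] xy2.
  by move=> ->; rewrite /d metric_sym -/d; move: xy2; rewrite mul0r; lra.
have yb b : d x b = m.+1%:R * delta -> d x b <= d x y - rho by lra.
move=> [b [xb wb hb]]; have wb0 : 0 < weight b y by lra.
case: hb => [[-> _]|[-> hb]].
  have [w [Yw Twb yw]] := weight_gt0 wb0.
  have := T_dist Yw Twb; have := metric_triangle y w b.
  by have := metric_triangle x y w; rewrite -/d; lra.
have [|w [_ _ _ yw wp]] := parent_reach Yy (yb b xb) _ wb0 hb.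
  by rewrite xb level_ge_del.
by have := metric_triangle y w (parent b); rewrite -/d; lra.
Qed.

(** By the Lipschitz estimates every label of a point of [S] is visible from
    [y0], where it comes from a segment that starts below the cut (in [U]) or
    ends above it (in [L]). Only one segment does both, by [offset_lt]. *)
Lemma label_card_same (S : set X) y0 m : S `<=` Y ->
  (forall y z, S y -> S z -> d y z < e) -> S y0 ->
  (forall y, S y -> window y = m.+1) ->
  [set v | exists2 y, S y & label y v] #<= `I_k.+1.
Proof.
move=> SY Se Sy0 Sm; have Yy0 := SY _ Sy0.
pose t : R := m.+1%:R * delta.
have t0 : 0 <= t by apply: le_trans (level_ge_del m); exact: ltW delta0.
have lev y : S y -> t <= d x y - rho.
  by move=> /Sm wy; have := @window_ge y; rewrite wy => /(_ isT); rewrite /t; lra.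
pose U := [set b | active t y0 b /\ offset b y0 < height b y0].
pose L := [set b | active t y0 b /\ height b y0 < offset b y0 + weight b y0].
have UL b b' : U b -> L b -> U b' -> L b' -> lt b b' -> False.
  move=> [[xb wb] _] [_ hL] [[xb' wb'] hU] _ bb'.
  have := @offset_lt b b' y0 Yy0; rewrite xb xb' => /(_ (lev _ Sy0) erefl wb bb').
  by move: hL hU; rewrite /height xb xb'; lra.
apply: card_le_trans (@card_le_cut _ _ U L parent k
  (active_card Yy0 t0 (lev _ Sy0)) _ _ _); last 1 first.
- move=> b b' Ub Lb Ub' Lb'; apply/eqP; apply/negPn/negP => /lt_tot/orP[] h.
    exact: (UL b b').
  exact: (UL b' b).
- apply: subset_card_le => v [y Sy]; rewrite /label (Sm _ Sy).
  move=> [b [xb wb hb]].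
  have yy0 := Se _ _ Sy Sy0; have y0y := Se _ _ Sy0 Sy.
  have w1 := weight_lipschitz b yy0.
  have [blev blev0] : d x b <= d x y - rho /\ d x b <= d x y0 - rho.
    by rewrite xb; split; exact: lev.
  have o1 := offset_lipschitz (SY _ Sy) Yy0 blev blev0 yy0.
  have o2 := offset_lipschitz Yy0 (SY _ Sy) blev0 blev y0y.
  have h1 := height_lipschitz b yy0; have h2 := height_lipschitz b y0y.
  have Ab : active t y0 b by split => //; have := eltD; have := e0; lra.
  have eD' := eD.
  case: hb => [[-> hb]|[-> hb]].
    by left; split => //; have := e0; lra.
  by right; exists b => //; split => //; have := e0; lra.
- by move=> b [].
- by move=> b [].
Qed.

(** All labels lie on the level [t] of the lower window: a point below the
    boundary has a height exceeding all its segments, so that no parent occurs,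
    and a point above it has a height below [D / 2], so that only parents
    occur. Being on geodesics that end near [y2], they are bounded by tightness
    at scale [delta]. *)
Lemma label_card_step (S : set X) y1 y2 : S `<=` Y ->
  (forall y z, S y -> S z -> d y z < e) -> S y1 -> S y2 ->
  (window y1 < window y2)%N ->
  [set v | exists2 y, S y & label y v] #<= `I_k.
Proof.
move=> SY Se Sy1 Sy2 w12; have Yy2 := SY _ Sy2.
have delta0' := delta0; have dge := delta_ge; have KD0' := KD0; have D0' := D0.
have rho0' := rho0; have e0' := e0.
have [n w2] : exists n, window y2 = n.+1 by case: (window y2) w12 => // n; exists n.
pose t : R := n%:R * delta.
have t0 : 0 <= t by rewrite mulr_ge0// ltW.
have tS : n.+1%:R * delta = t + delta by exact: levelS.
have xy2 : t + delta + rho <= d x y2.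
  by have := @window_ge y2; rewrite w2 tS => /(_ isT).
have xy1 : d x y1 < t + delta + rho.
  have := window_lt y1; have : (window y1)%:R * delta <= t.
    by apply: level_le; rewrite -ltnS -w2.
  lra.
have ty2 : t <= d x y2 - delta by lra.
apply: card_le_trans (tight delta0 Yy2 t0 ty2).
apply: subset_card_le => v [y Sy]; have Yy := SY _ Sy.
have y2y := Se _ _ Sy2 Sy.
have near w : d y w < D + 2 * (rho + (K + 1) * D) -> ball y2 (eps * delta) w.
  rewrite ballEmdist/= -/d => yw; have := metric_triangle y2 y w.
  by rewrite -/d; have := eps_delta; lra.
have xy : t + delta + rho - e < d x y.
  by have := metric_triangle x y y2; rewrite (metric_sym y y2) -/d; lra.
have xyu : d x y < t + delta + rho + e.
  have := Se _ _ Sy1 Sy; have := metric_triangle x y1 y; rewrite -/d; lra.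
have wn : window y = n \/ window y = n.+1.
  have wlt := window_lt y; have wge := @window_ge y.
  case: (ltngtP (window y) n) => wn; [exfalso|right|by left].
    by have := level_le wn; rewrite levelS -/t; lra.
  apply/eqP; rewrite eqn_leq wn andbT leqNgt; apply/negP => wn2.
  have := level_le wn2; rewrite levelS tS.
  by have := wge (leq_trans (ltn0Sn _) wn2); lra.
rewrite /label; have := @window_ge y.
case: wn => ->; last first.
  rewrite tS => /(_ isT) xyy [b [xb wb hb]].
  have wb0 : 0 < weight b y by lra.
  have blev : d x b <= d x y - rho by lra.
  have o0 : 0 <= offset b y by apply: sumr_ge0 => a _; exact: weight_ge0.
  case: hb => [[_ hb]|[-> hb]].
    by exfalso; move: hb; rewrite /height; have := eltD; lra.
  have [|w [Yw Tw xp yw _]] := parent_reach Yy blev _ wb0 hb.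
    by rewrite xb; lra.
  split; first by exists w => //; split => //; exact: near.
  by rewrite /metric_sphere/= -/d xp; lra.
rewrite -/t; case nE: n => [|m].
  (* In window 0 the only label is [x], which lies on every geodesic. *)
  move=> _ ->; have [|b Tb xb] := T_level Yy2 (lexx 0); first exact: mdist_ge0.
  have bE : x = b by exact: mdist_positivity xb.
  split; last by rewrite /metric_sphere/= mdistxx /t nE mul0r.
  exists y2; last by rewrite [X in _ X]bE.
  split => //; apply: near.
  have := Se _ _ Sy Sy2; have := eltD.
  have : 0 <= (K + 1) * D by rewrite mulrDl mul1r; lra.
  rewrite -/d; lra.
have <- : t = m.+1%:R * delta by rewrite /t nE.
move=> /(_ isT) xyy [b [xb wb hb]].
have wb0 : 0 < weight b y by lra.
have blev : d x b <= d x y - rho by rewrite xb; lra.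
case: hb => [[-> hb]|[_ hb]].
  have [w [Yw Twb yw]] := weight_gt0 wb0.
  split; last by rewrite /metric_sphere/= -/d xb.
  exists w => //; split => //; apply: near; lra.
by exfalso; have := offset_weight_le Yy blev wb0; move: hb; rewrite /height; lra.
Qed.

Lemma label_card (S : set X) : S `<=` Y ->
  (forall y z, S y -> S z -> d y z < e) ->
  [set v | exists2 y, S y & label y v] #<= `I_k.+1.
Proof.
move=> SY Se.
have [[y1 [y2 [Sy1 Sy2 w12]]]|none] := pselect (exists y1 y2,
    [/\ S y1, S y2 & (window y1 < window y2)%N]).
  apply: card_le_trans (label_card_step SY Se Sy1 Sy2 w12) _.
  by rewrite card_le_II.
have [[y0 Sy0]|noS] := pselect (exists y, S y); last first.
  by apply: (@seq_card_le _ _ [::]) => // v [y Sy]; case: noS; exists y.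
have same y : S y -> window y = window y0.
  move=> Sy; have [w|w|//] := ltngtP (window y) (window y0); case: none.
    by exists y, y0.
  by exists y0, y.
case w0: (window y0) => [|m]; last first.
  by apply: (label_card_same SY Se Sy0) => y /same ->; exact: w0.
apply: (@seq_card_le _ _ [:: x]) => // v [y /same wy].
by rewrite /label wy w0 /= inE => ->.
Qed.

End AnnularCover.

(** * From labels to covers *)

Lemma geodesic_level (R : realType) (X : metricType R) (x y : X) (A : set X) (t : R) :
  is_geodesic x y A -> 0 <= t -> t <= mdist x y ->
  exists2 b, A b & mdist x b = t.
Proof.
move=> [g [g0 _ gi ->]] t0 ty; exists (g t).
  by exists t => //=; rewrite in_itv/= t0.
rewrite -{1}g0 gi ?in_itv/= ?lexx ?mdist_ge0 ?t0//.
by rewrite sub0r normrN ger0_norm.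
Qed.

Lemma geodesic_dist (R : realType) (X : metricType R) (x y b : X) (A : set X) :
  is_geodesic x y A -> A b -> mdist y b = mdist x y - mdist x b.
Proof.
move=> [g [g0 g1 gi ->]] [t]; rewrite /= in_itv/= => /andP[t0 ty] <-.
have -> : mdist x (g t) = t.
  by rewrite -{1}g0 gi ?in_itv/= ?lexx ?mdist_ge0 ?t0// sub0r normrN ger0_norm.
rewrite -{1}g1 gi ?in_itv/= ?lexx ?mdist_ge0 ?t0 ?ty//.
by rewrite ger0_norm// subr_ge0.
Qed.

Lemma cobounded_near (R : realType) (X : metricType R) (Y : set X) :
  cobounded Y -> exists2 c : R, 0 < c & forall z, exists2 y, Y y & mdist z y < c.
Proof.
move=> [c c0 Yc]; exists (c + 1); first by rewrite addr_gt0.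
move=> z; have : (edist_inf Y z < (c + 1)%:E)%E.
  by apply: le_lt_trans (Yc z) _; rewrite lte_fin ltrDl.
move=> /ereal_inf_lt[_ [y Yy <-]] /edist_lt_ball /=.
by rewrite ballEmdist => zy; exists y.
Qed.

Lemma diam_le (R : realType) (X : metricType R) (V : set X) (v : X) (C : R) :
  (forall z, V z -> mdist z v <= C) -> (diam V <= (C + C)%:E)%E.
Proof.
move=> VC; apply: ge_ereal_sup => _ [[z w] /= [Vz Vw] <-]; rewrite lee_fin.
apply: le_trans (metric_triangle z v w) _.
by rewrite lerD ?VC// metric_sym VC.
Qed.

(** The cell of [v] consists of the points at distance less than [c] from a point
    of [Y] labelled [v]. The points of [Y] witnessing that cells meet a ball of
    radius [r] form a set of diameter less than [2 * (r + c)]. *)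
Lemma cover_of_labels (R : realType) (X : metricType R) (Y : set X) (c r C : R)
    (n : nat) (label : X -> X -> Prop) :
  (forall z, exists2 y, Y y & mdist z y < c) ->
  (forall y, Y y -> exists v, label y v) ->
  (forall y v, Y y -> label y v -> mdist y v <= C) ->
  (forall S : set X, S `<=` Y ->
    (forall y z, S y -> S z -> mdist y z < 2 * (r + c)) ->
    [set v | exists2 y, S y & label y v] #<= `I_n) ->
  exists F : set (set X),
    [/\ \bigcup_(V in F) V = [set: X], multiplicity_le r n F
      & forall V, F V -> (diam V <= (c + C + (c + C))%:E)%E].
Proof.
move=> Yc lex ldist lcard.
pose cell v := [set z | exists2 y, Y y /\ label y v & mdist z y < c].
exists (range cell); split.
- apply/seteqP; split => // z _; have [y Yy zy] := Yc z.
  have [v yv] := lex _ Yy.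
  by exists (cell v); [exists v | exists y].
- move=> z; pose S := [set y | Y y /\ mdist z y < r + c].
  apply: card_le_trans (lcard S _ _); last 2 first.
  + by move=> y [].
  + move=> y w [_ zy] [_ zw]; have := metric_triangle y z w.
    by rewrite (metric_sym y z); lra.
  apply: card_le_trans (card_image_le cell _).
  apply: subset_card_le => V [[v _ <-] [w [[y [Yy yv] wy] zw]]].
  exists v => //; exists y => //; split => //.
  by move: zw; rewrite ballEmdist/=; have := metric_triangle z w y; lra.
- move=> _ [v _ <-]; apply: (@diam_le _ _ _ v) => z [y [Yy yv] zy].
  by have := ldist _ _ Yy yv; have := metric_triangle z y v; lra.
Qed.

Unset Implicit Arguments.
Set Strict Implicit.

Theorem proposition3p4 (R : realType) (X : metricType R) (x : X) (k : nat)
    (Xgeo : geodesic_space X) :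
  (exists2 eps : R, 0 < eps &
    exists (Y : set X) (T : X -> set X),
      geodesic_combing x Y T /\ tight_combing eps k x Y T) ->
  asdimAN_le X k.
Proof.
move=> [eps eps0 [Y [T [[/cobounded_near[c c0 Yc] Tgeo] tight]]]].
have [lt [lt_irr lt_tr lt_tot]] := strict_total_order_exists X.
have K0 : 0 <= k%:R :> R := ler0n _ k.
(* With [s := r + c], the scales [e], [D], [rho], [delta] are [2 * s] and the
   multiples of [s] by [alpha], [beta], [gamma]. *)
pose K : R := k%:R.
pose alpha : R := 2 * (2 * (K + 2)) + 1.
pose beta : R := alpha / eps.
pose gamma : R := K * alpha + 2 + alpha +
  (2 + 2 * alpha + 2 * (beta + (K + 1) * alpha)) / eps.
pose C : R := alpha + 3 * (beta + (K + 1) * alpha) + gamma.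
have a0 : 0 < alpha by rewrite /alpha /K; lra.
have Ka0 : 0 <= K * alpha by rewrite mulr_ge0// ltW.
have b0 : 0 < beta by rewrite divr_gt0.
have E0 : 0 < 2 + 2 * alpha + 2 * (beta + (K + 1) * alpha).
  by rewrite mulrDl mul1r; lra.
have g0 : 0 < gamma.
  by have := divr_gt0 E0 eps0; rewrite /gamma; lra.
have C0 : 0 < C by rewrite /C mulrDl mul1r; lra.
exists (2 * C), (2 * (C + 1) * c); split.
- by rewrite mulr_gt0.
- by rewrite mulr_gt0// mulr_gt0// addr_gt0.
move=> r r0; pose s := r + c; have s0 : 0 < s by rewrite addr_gt0.
have -> : 2 * C * r + 2 * (C + 1) * c = c + C * s + (c + C * s).
  by rewrite /s; lra.
have lev y t : Y y -> 0 <= t -> t <= mdist x y -> exists2 b, T y b & mdist x b = t.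
  by move=> /Tgeo; exact: geodesic_level.
have Tdist y b : Y y -> T y b -> mdist y b = mdist x y - mdist x b.
  by move=> /Tgeo; exact: geodesic_dist.
have h1 : 0 < 2 * s by rewrite mulr_gt0.
have h2 : (K + 2) * (2 * s) + (K + 2) * (2 * s) < alpha * s by rewrite /alpha; lra.
have h3 : alpha * s <= eps * (beta * s).
  by rewrite mulrA /beta mulrCA divff ?gt_eqF// mulr1.
have h4 : K * (alpha * s) + 2 * s + alpha * s <= gamma * s.
  have -> : K * (alpha * s) + 2 * s + alpha * s = (K * alpha + 2 + alpha) * s by lra.
  by rewrite ler_pM2r// /gamma lerDl divr_ge0 ?(ltW E0) ?(ltW eps0).
have h5 : 2 * s + 2 * (alpha * s) + 2 * (beta * s + (K + 1) * (alpha * s)) <=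
    eps * (gamma * s).
  have -> : 2 * s + 2 * (alpha * s) + 2 * (beta * s + (K + 1) * (alpha * s)) =
     (2 + 2 * alpha + 2 * (beta + (K + 1) * alpha)) * s by lra.
  rewrite mulrA ler_pM2r// /gamma [leRHS]mulrDr (mulrC eps (_ / _)) divfK ?gt_eqF//.
  by rewrite lerDr mulr_ge0 ?(ltW eps0)//; lra.
apply: (@cover_of_labels _ _ Y c r (C * s) k.+1
  (label x Y T k lt (alpha * s) (beta * s) (gamma * s))) => //.
- move=> y; exact: (label_exists lt lev eps0 h1 h2 h3 h4).
- move=> y v Yy yv.
  have := label_dist lt_irr lev Tdist tight eps0 h1 h2 h3 h4 Yy yv.
  by rewrite /C -/K; lra.
- move=> S; exact: (label_card lt_irr lt_tr lt_tot lev Tdist tight eps0 h1 h2 h3 h4 h5).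
Qed.
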